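(* Let $\lambda$ be a partition with $n$ parts, at least one equal to $0$, let $x_1,\dots,x_n>0$, $t\in[0,1)$, and fix $k<n$. Let $O$ be any observable (event or random variable) of the configuration of the multispecies $t$-PushTASEP with content $\lambda$ that depends only on the configuration in sites $1,2,\dots,k$. Then the expectation (or probability) $\langle O\rangle$ of $O$ in the stationary distribution is symmetric in the parameters $x_{k+1},\dots,x_n$.
   Context: Sites $1,\dots,n$ ($n\ge 2$) lie on a ring with clockwise order $1\to2\to\cdots\to n\to1$. For a partition $\lambda$, $S_\lambda$ is the set of compositions $\eta=(\eta_1,\dots,\eta_n)$ that are rearrangements of $\lambda$; $\eta_j$ is the species at site $j$, species $0$ meaning vacancy. Write $[m]_t=1+t+\dots+t^{m-1}$. The multispecies $t$-PushTASEP with content $\lambda$ is the continuous-time Markov chain on $S_\lambda$ in which each site $j$ has an independent exponential clock (bell) of rate $1/x_j$. When the bell at $j$ rings in configuration $\eta$: if $\eta_j=0$ nothing changes. Otherwise the particle at $j$ becomes active. An active particle of species $r$ at site $p$: let $m$ be the number of parts of $\lambda$ smaller than $r$; list the $m$ sites $i$ with $\eta_i<r$ (values before the bell rang) in clockwise order starting from the site after $p$; the particle moves to the $k$-th listed site with probability $t^{k-1}/[m]_t$, displacing the particle there; if the displaced species is nonzero that particle becomes active there and repeats, otherwise the procedure stops. Afterwards site $j$ is vacant, each site where an active particle settled holds it, other sites are unchanged; this is one transition. The stationary distribution is that of this (irreducible) chain. *)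

(* Defs.v *)
From HB Require Import structures.
From mathcomp Require Import all_boot all_order all_algebra all_fingroup.
From mathcomp Require Import reals.

Set Implicit Arguments.
Unset Strict Implicit.
Unset Printing Implicit Defensive.

Import Order.TTheory GRing.Theory Num.Theory.
Local Open Scope ring_scope.

(* Sites 1, ..., n are the ordinals 0, ..., n - 1 of 'I_n; the clockwise      *)
(* neighbour of a site is its cyclic successor ordS.                          *)

(* The set S_lambda of rearrangements of lam. *)
Record config (n : nat) (lam : n.-tuple nat) := Config {
  species :> {ffun 'I_n -> nat};
  configP : perm_eq (codom species) lam }.

HB.instance Definition _ (n : nat) (lam : n.-tuple nat) :=
  [isSub for @species n lam].
HB.instance Definition _ (n : nat) (lam : n.-tuple nat) :=
  [Countable of config lam by <:].

Section ConfigFinite.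
Variables (n : nat) (lam : n.-tuple nat).

Definition config_enum : seq (config lam) :=
  undup (pmap (fun s : seq nat => insub [ffun i : 'I_n => nth 0%N s i])
              (permutations lam)).

Lemma config_enumP : Finite.axiom config_enum.
Proof.
apply: Finite.uniq_enumP; first exact: undup_uniq.
move=> eta; rewrite mem_undup mem_pmap; apply/mapP.
exists (codom eta); first by rewrite mem_permutations configP.
rewrite (_ : [ffun _ => _] = species eta) ?valK //.
apply/ffunP=> i; rewrite ffunE codomE (nth_map i) ?size_enum_ord //.
by rewrite nth_ord_enum.
Qed.

HB.instance Definition _ := isFinite.Build (config lam) config_enumP.
End ConfigFinite.

Section Dynamics.
Variables (R : realType) (n : nat) (t : R).
Implicit Types (eta zeta cur : {ffun 'I_n -> nat}) (p j : 'I_n).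

Definition qint (m : nat) : R := \sum_(i < m) t ^+ i.

Definition set_site cur p (r : nat) : {ffun 'I_n -> nat} :=
  [ffun i => if i == p then r else cur i].

(* traject lists all n sites clockwise from the one after p, ending with p,   *)
(* which the strict inequality discards.                                      *)
Definition weaker_sites eta p : seq 'I_n :=
  [seq i <- traject (@ordS n) (ordS p) n | (eta i < eta p)%N].

(* Probability that the cascade ends in zeta, when eta is the configuration   *)
(* before the bell, cur the configuration built so far, and the particle of   *)
(* species eta p has just been removed from p by the bell or by displacement. *)
(* Each displaced particle is still where it was in eta, because a cascade    *)
(* never visits a site twice. List positions start at 0, hence t ^+ i. The    *)
(* species of successive active particles strictly decrease, so fuel larger   *)
(* than eta p is never exhausted.                                             *)
Fixpoint cascade_prob (fuel : nat) eta p cur zeta : R :=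
  if fuel is fuel'.+1 then
    if eta p == 0%N then (cur == zeta)%:R
    else
      let s := weaker_sites eta p in
      \sum_(i < size s)
        t ^+ i / qint (size s) *
        (let q := nth p s i in
         cascade_prob fuel' eta q (set_site cur q (eta p)) zeta)
  else 0.

Definition bell_prob j eta zeta : R :=
  cascade_prob (eta j).+1 eta j (set_site eta j 0) zeta.

End Dynamics.

Section Stationary.
Variables (R : realType) (n : nat) (lam : n.-tuple nat) (t : R).
Variable x : 'I_n -> R.

Definition jump_rate (eta zeta : config lam) : R :=
  \sum_(j < n) (x j)^-1 * bell_prob t j eta zeta.

Definition generator (eta zeta : config lam) : R :=
  if eta == zeta then - \sum_(xi | xi != eta) jump_rate eta xi
  else jump_rate eta zeta.

Definition is_stationary (pi : config lam -> R) : Prop :=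
  [/\ forall eta, 0 <= pi eta,
      \sum_eta pi eta = 1
    & forall zeta, \sum_eta pi eta * generator eta zeta = 0].

End Stationary.

Section Observables.
Variables (R : realType) (n : nat) (lam : n.-tuple nat).

Definition expectation (pi : config lam -> R) (O : config lam -> R) : R :=
  \sum_eta pi eta * O eta.

Definition probability (pi : config lam -> R) (A : {set config lam}) : R :=
  \sum_(eta in A) pi eta.

Definition depends_on_first (T : Type) (k : nat) (O : config lam -> T) : Prop :=
  forall eta zeta : config lam,
    (forall i : 'I_n, (i < k)%N -> eta i = zeta i) -> O eta = O zeta.

End Observables.

(* Main.v *)
Require Import Defs.
From HB Require Import structures.
From mathcomp Require Import all_boot all_order all_algebra all_fingroup.
From mathcomp Require Import reals ring lra zify.

(* Write B_j for the operator "ring the bell at j" on functions of the        *)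
(* configuration, so that the generator is L_x = sum_j (B_j - 1) / x_j. The   *)
(* geometric choice of a target means that an active particle walks clockwise *)
(* and settles at each weaker site it meets with probability 1 - t, as long   *)
(* as it takes. Storing the species of the active particle at the bell site,  *)
(* one turn around the ring is a product of two-site operators V_(j,k), and   *)
(* B_j f is the unique function fixed by that product which agrees with f on  *)
(* the configurations vacant at j. The V_(j,k) satisfy the Yang-Baxter        *)
(* equation, and T = V_(i,i+1) followed by the exchange of the two sites is a *)
(* Hecke generator. Hence T commutes with B_j for j <> i, i+1, and            *)
(*   B_i T = T B_(i+1),   B_(i+1) (T - (1 - t)) = (T - (1 - t)) B_i.          *)
(* With a = 1/x_i, b = 1/x_(i+1) and Q = b (1 - t) + (a - b) T this yields    *)
(* L_x Q = Q L_x', where x' is x with x_i and x_(i+1) exchanged. Since Q acts *)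
(* as the scalar a - t b on functions that do not distinguish sites i and     *)
(* i+1, stationary means of such functions are the same for x and x'. If the  *)
(* scalar vanishes, exchange the roles of x and x': both scalars cannot be 0. *)

Set Implicit Arguments.
Unset Strict Implicit.
Unset Printing Implicit Defensive.

Import Order.TTheory GRing.Theory Num.Theory.
Local Open Scope ring_scope.

(** The operator relations become a statement on expectations by duality. Say that [f] has mean [c]
    for the parameters [x] when [f - c] lies in the range of the generator. A stationary
    distribution annihilates this range, hence integrates [f] to [c] ([mean_stationary]). By the
    maximum principle harmonic functions are constant ([harmonic_cst]): a maximum propagates along
    moves of positive probability, and greedy bells lead from every configuration to one and the
    same. So the range has codimension one and misses the nonzero constants, and every function has
    exactly one mean ([mean_exists], [mean_unique]).

    An observable of the first [k] sites does not see exchanges of later sites, so L_x Q = Q L_x'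
    ([gen_op_exchange]) transports its mean between x and x' ([mean_adjacent]); adjacent
    transpositions generate the rest ([mean_perm]). The relations between T and the bells need no
    formula for the cascade: by [lap_fixed_unique] it suffices to treat one lap and the
    configurations vacant at the bell. *)

(** * Laps around the ring *)

Section Sites.
Variable n : nat.
Implicit Types i j k : 'I_n.

Lemma val_iter_ordS m j : val (iter m (@ordS n) j) = ((j + m) %% n)%N.
Proof.
elim: m => [|m IHm]; first by rewrite addn0 modn_small.
by rewrite iterS /= IHm -addn1 modnDml addn1 addnS.
Qed.

Lemma iter_ordS_n j : iter n (@ordS n) j = j.
Proof. by apply: val_inj; rewrite val_iter_ordS modnDr modn_small. Qed.

Definition lap j : seq 'I_n := traject (@ordS n) (ordS j) n.

Lemma mem_lap i j : i \in lap j.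
Proof.
have n_gt0 : (0 < n)%N by apply: leq_ltn_trans (ltn_ord i).
apply/trajectP; exists ((i + (n - ordS j)) %% n)%N; first exact: ltn_pmod.
apply: val_inj; rewrite val_iter_ordS modnDmr addnCA subnKC ?modnDr ?modn_small //.
exact/ltnW/ltn_ord.
Qed.

Lemma lap_uniq j : uniq (lap j).
Proof.
apply/card_uniqP; rewrite size_traject.
rewrite (eq_card (B := 'I_n)) ?card_ord // => i; exact: mem_lap.
Qed.

Lemma lap_adjacent i j : j != i -> j != ordS i ->
  exists l1 l2, [/\ lap j = l1 ++ [:: i, ordS i & l2],
    i \notin l1 ++ l2 & ordS i \notin l1 ++ l2].
Proof.
move=> ji jSi; have := lap_uniq j; have := mem_lap i j.
have lapj : last j (lap j) = j by rewrite last_traject iter_ordS_n.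
have fp : fpath (@ordS n) j (lap j) by rewrite fpath_traject.
move=> il; case/splitPr: il lapj fp => l1 [|k l2].
  by rewrite last_cat /= => ij; rewrite ij eqxx in ji.
rewrite cat_path /= => _ /and4P[_ _ /eqP <- _].
rewrite cat_uniq /= !inE !negb_or => /and3P[_ /and3P[il1 Sl1 _] /and3P[/andP[_ il2] Sl2 _]].
by exists l1, l2; rewrite !mem_cat !negb_or il1 Sl1 il2 Sl2.
Qed.

Lemma lap_ends i : i != ordS i ->
  exists l, [/\ lap i = ordS i :: rcons l i, lap (ordS i) = l ++ [:: i; ordS i],
    i \notin l & ordS i \notin l].
Proof.
move=> iSi; have := lap_uniq i; have := lap_uniq (ordS i); have := iter_ordS_n i.
rewrite /lap; case: (n) i iSi => [|[|n']] i iSi; first by case: (i).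
  by case/eqP: iSi; rewrite [LHS]ord1 [RHS]ord1.
rewrite -[traject _ (ordS i) _]/(ordS i :: traject (@ordS n'.+2) (ordS (ordS i)) n'.+1).
rewrite !trajectSr -!iterSr => iE; rewrite [iter n'.+3 _ _]iterS iE.
rewrite /= rcons_uniq rcons_uniq mem_rcons inE negb_or => /and3P[/andP[_ Sl] il _] _.
by exists (traject (@ordS n'.+2) (ordS (ordS i)) n'); rewrite -!cats1 -catA.
Qed.

End Sites.

(** * Two-site operators: Yang-Baxter and Hecke relations *)

Section Operators.
Variables (R : realType) (n : nat) (lam : n.-tuple nat) (t : R).
Local Notation C := (config lam).
Local Notation fn := {ffun C -> R^o}.
Implicit Types (f g h : fn) (eta : C) (i j k : 'I_n).

Lemma fn_addE f g eta : (f + g) eta = f eta + g eta.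
Proof. by rewrite ffunE. Qed.

Lemma fn_oppE f eta : (- f) eta = - f eta.
Proof. by rewrite ffunE. Qed.

Lemma fn_scaleE a f eta : (a *: f) eta = a * f eta.
Proof. by rewrite ffunE. Qed.

Definition raw_swap (c : {ffun 'I_n -> nat}) i j : {ffun 'I_n -> nat} :=
  [ffun k => c (tperm i j k)].

Lemma raw_swapP eta i j : perm_eq (codom (raw_swap eta i j)) lam.
Proof.
apply: perm_trans (configP eta); rewrite !codomE.
rewrite (eq_map (g := eta \o tperm i j)); last by move=> k; rewrite ffunE.
rewrite map_comp; apply/perm_map/uniq_perm; rewrite ?enum_uniq //.
  by rewrite (map_inj_uniq perm_inj) enum_uniq.
move=> k; rewrite mem_enum; apply/mapP.
by exists (tperm i j k); rewrite ?mem_enum ?tpermK.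
Qed.

Definition swap i j eta : C := Config (raw_swapP eta i j).

Lemma swapE i j eta k : swap i j eta k = eta (tperm i j k).
Proof. by rewrite /= ffunE. Qed.

Lemma config_eqP eta (zeta : C) : (forall k, eta k = zeta k) -> eta = zeta.
Proof. by move=> e; apply/val_inj/ffunP. Qed.

Lemma swapC i j eta : swap i j eta = swap j i eta.
Proof. by apply: config_eqP => k; rewrite !swapE tpermC. Qed.

Lemma swapK i j : involutive (swap i j).
Proof. by move=> eta; apply: config_eqP => k; rewrite !swapE tpermK. Qed.

Lemma swap_id i j eta : eta i = eta j -> swap i j eta = eta.
Proof. by move=> e; apply: config_eqP => k; rewrite swapE; case: tpermP => [->|->|]. Qed.

Definition scatter j k f : fn :=
  [ffun eta : C => if (eta k < eta j)%N
               then (1 - t) * f (swap j k eta) + t * f eta else f eta].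

Definition flip i k f : fn := [ffun eta : C => f (swap i k eta)].

Lemma scatterE j k f eta : scatter j k f eta =
  if (eta k < eta j)%N then (1 - t) * f (swap j k eta) + t * f eta else f eta.
Proof. by rewrite ffunE. Qed.

Lemma flipE i k f eta : flip i k f eta = f (swap i k eta).
Proof. by rewrite ffunE. Qed.

Definition hecke i k f : fn := scatter i k (flip i k f).

(** On functions the outermost factor is the first site met; the last one, [j] itself, acts as the
    identity. *)
Definition lap_op j f : fn := foldr (scatter j) f (lap j).

Lemma scatter_linear j k : linear (scatter j k).
Proof.
move=> a f g; apply/ffunP => eta; rewrite !ffunE.
by case: ifP => _; rewrite /GRing.scale /=; [ring|].
Qed.

Lemma flip_linear i k : linear (flip i k).
Proof. by move=> a f g; apply/ffunP => eta; rewrite !ffunE. Qed.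

Lemma hecke_linear i k : linear (hecke i k).
Proof. by move=> a f g; rewrite /hecke flip_linear scatter_linear. Qed.

Lemma foldr_scatter_linear j l : linear (fun f => foldr (scatter j) f l).
Proof. by move=> a f g; elim: l => //= k l ->; rewrite scatter_linear. Qed.

Lemma lap_op_linear j : linear (lap_op j).
Proof. by move=> a f g; rewrite /lap_op foldr_scatter_linear. Qed.

HB.instance Definition _ j k := GRing.isLinear.Build R fn fn _ _ (@scatter_linear j k).
HB.instance Definition _ j k := GRing.isLinear.Build R fn fn _ _ (@flip_linear j k).
HB.instance Definition _ j k := GRing.isLinear.Build R fn fn _ _ (@hecke_linear j k).
HB.instance Definition _ j := GRing.isLinear.Build R fn fn _ _ (@lap_op_linear j).

Lemma flipK i k : involutive (flip i k).
Proof. by move=> f; apply/ffunP => eta; rewrite !(scatterE, flipE) swapK. Qed.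

Lemma flipC i k f : flip i k f = flip k i f.
Proof. by apply/ffunP => eta; rewrite !(scatterE, flipE) swapC. Qed.

Lemma scatter_refl j f : scatter j j f = f.
Proof. by apply/ffunP => eta; rewrite !(scatterE, flipE) ltnn. Qed.

Lemma flip_scatter i k f : flip i k (scatter k i f) = scatter i k (flip i k f).
Proof.
apply/ffunP => eta; rewrite !(scatterE, flipE) !swapE tpermL tpermR.
by case: ifP => // _; rewrite (swapC k i).
Qed.


Ltac swap_eq :=
  apply: config_eqP => ?; rewrite !swapE; f_equal; rewrite !permE /=;
  repeat match goal with |- context [?a == ?b] =>
    is_var a; is_var b; case: (@eqP _ a b) => ? /= end;
  congruence.

Lemma flip_scatter_out i k j f : j != i -> j != k ->
  flip i k (scatter k j f) = scatter i j (flip i k f).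
Proof.
move=> /eqP ji /eqP jk; apply/ffunP => eta.
rewrite !(scatterE, flipE) !swapE tpermR tpermD; try by apply/eqP; congruence.
case: ifP => // _; congr (_ * f _ + _); swap_eq.
Qed.

Lemma flip_scatter_in i k j f : j != i -> j != k ->
  flip i k (scatter j i f) = scatter j k (flip i k f).
Proof.
move=> /eqP ji /eqP jk; apply/ffunP => eta.
rewrite !(scatterE, flipE) !swapE tpermL tpermD; try by apply/eqP; congruence.
case: ifP => // _; congr (_ * f _ + _); swap_eq.
Qed.

Lemma flip_scatter_far i k j l f : j != i -> j != k -> l != i -> l != k ->
  flip i k (scatter j l f) = scatter j l (flip i k f).
Proof.
move=> /eqP ji /eqP jk /eqP li /eqP lk; apply/ffunP => eta.
rewrite !(scatterE, flipE) !swapE !tpermD; try by apply/eqP; congruence.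
case: ifP => // _; congr (_ * f _ + _); swap_eq.
Qed.

Lemma scatter_far i k j l f : j != i -> j != k -> l != i -> l != k ->
  scatter i k (scatter j l f) = scatter j l (scatter i k f).
Proof.
move=> /eqP ji /eqP jk /eqP li /eqP lk; apply/ffunP => eta.
rewrite !(scatterE, flipE) !swapE !tpermD; try by apply/eqP; congruence.
have -> : swap i k (swap j l eta) = swap j l (swap i k eta) by swap_eq.
by do 2![case: ifP => // _]; ring.
Qed.

Lemma yang_baxter j i k f : j != i -> j != k -> i != k ->
  scatter j i (scatter j k (scatter i k f)) =
  scatter i k (scatter j k (scatter j i f)).
Proof.
move=> /eqP ji /eqP jk /eqP ik; apply/ffunP => eta.
have e1 (c : C) : swap i k (swap j i c) = swap j i (swap j k c) by swap_eq.
have e2 (c : C) : swap j k (swap i k c) = swap j i (swap j k c) by swap_eq.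
have e3 (c : C) : swap j k (swap j i c) = swap j i (swap i k c) by swap_eq.
have e4 (c : C) : swap i k (swap j k c) = swap j i (swap i k c) by swap_eq.
have e5 : tperm j i k = k by apply: tpermD; apply/eqP; congruence.
have e6 : tperm j k i = i by apply: tpermD; apply/eqP; congruence.
have e7 : tperm i k j = j by apply: tpermD; apply/eqP; congruence.
rewrite !scatterE !swapE !(tpermL, tpermR, e5, e6, e7).
rewrite !(e1, e2, e3, e4, swapK).
case: (ltngtP (eta i) (eta j)) => h1; case: (ltngtP (eta k) (eta j)) => h2;
  case: (ltngtP (eta k) (eta i)) => h3; try lia; try ring.
(* In the two ties left, exchanging equal species identifies configurations that [ring] sees as
   distinct. *)
- by rewrite -e2 (swap_id (esym h3)); ring.
- by rewrite -e3 (swap_id (esym h1)); ring.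
Qed.

Lemma hecke_far i k j l f : j != i -> j != k -> l != i -> l != k ->
  hecke i k (scatter j l f) = scatter j l (hecke i k f).
Proof. by move=> *; rewrite /hecke flip_scatter_far // scatter_far. Qed.

Lemma hecke_braid i k j f : j != i -> j != k -> i != k ->
  hecke i k (scatter j i (scatter j k f)) =
  scatter j i (scatter j k (hecke i k f)).
Proof.
move=> ji jk ik; rewrite /hecke yang_baxter //; congr (scatter i k _).
by rewrite flip_scatter_in // flipC flip_scatter_in // flipC.
Qed.

Lemma hecke_quadratic i k f :
  hecke i k (hecke i k f) = (1 - t) *: hecke i k f + t *: f.
Proof.
apply/ffunP => eta; rewrite /hecke fn_addE !fn_scaleE.
rewrite !(scatterE, flipE) !swapE !(tpermL, tpermR) !swapK.
case: (ltngtP (eta k) (eta i)) => h; try ring.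
by rewrite (swap_id (esym h)); ring.
Qed.

(** For nonzero [t] this is [t] times the inverse of T; written as a difference it also serves at
    [t = 0]. *)
Local Notation hecke' i k f := (hecke i k f - (1 - t) *: f).

Lemma hecke_flip i k f : hecke i k (flip i k f) = scatter i k f.
Proof. by rewrite /hecke flipK. Qed.

Lemma foldr_flip i k l f : i \notin l -> k \notin l ->
  foldr (scatter i) (flip i k f) l = flip i k (foldr (scatter k) f l).
Proof.
elim: l => //= j l IHl; rewrite !inE !negb_or => /andP[ij il] /andP[kj kl].
by rewrite IHl // flip_scatter_out // eq_sym.
Qed.

Lemma foldr_hecke i k j l f : j != i -> j != k -> i \notin l -> k \notin l ->
  foldr (scatter j) (hecke i k f) l = hecke i k (foldr (scatter j) f l).
Proof.
move=> ji jk; elim: l => //= h l IHl.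
rewrite !inE !negb_or => /andP[ih il] /andP[kh kl].
by rewrite IHl // hecke_far // eq_sym.
Qed.

Lemma lap_hecke_far i j f : i != ordS i -> j != i -> j != ordS i ->
  lap_op j (hecke i (ordS i) f) = hecke i (ordS i) (lap_op j f).
Proof.
move=> iS ji jS; rewrite /lap_op.
have [l1 [l2 [-> ]]] := lap_adjacent ji jS.
rewrite !mem_cat !negb_or => /andP[? ?] /andP[? ?].
by rewrite !foldr_cat /= foldr_hecke // -hecke_braid // foldr_hecke.
Qed.

(** The laps from [i] and [ordS i] meet the other sites in the same order, and the flip inside T
    turns one lap into the other. *)
Lemma lap_hecke i f : i != ordS i ->
  lap_op i (hecke i (ordS i) f) = hecke i (ordS i) (lap_op (ordS i) f).
Proof.
move=> iS; rewrite /lap_op; have [l [-> -> il Sl]] := lap_ends iS.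
rewrite /= foldr_rcons foldr_cat /= !scatter_refl /hecke -foldr_flip //.
by rewrite flip_scatter.
Qed.

Lemma hecke_hecke' i k f : hecke i k (hecke' i k f) = t *: f.
Proof. by rewrite linearB linearZ /= hecke_quadratic addrAC subrr add0r. Qed.

Lemma hecke'_scatter i k f : hecke' i k (scatter i k f) = t *: flip i k f.
Proof.
by rewrite -hecke_flip hecke_quadratic addrAC subrr add0r.
Qed.

Lemma scatter_hecke' i k f : scatter k i (hecke' i k f) = t *: flip i k f.
Proof.
rewrite -[scatter k i _](flipK i k) flip_scatter -/(hecke _ _ _).
by rewrite hecke_hecke' linearZ.
Qed.

(** On either side T - (1 - t) meets the scatter between the two sites and collapses with it to [t]
    times the flip, leaving only the common sites. *)
Lemma lap_hecke' i f : i != ordS i ->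
  lap_op (ordS i) (hecke' i (ordS i) f) = hecke' i (ordS i) (lap_op i f).
Proof.
move=> iS; rewrite /lap_op; have [l [-> -> il Sl]] := lap_ends iS.
rewrite /= foldr_rcons foldr_cat hecke'_scatter /= !scatter_refl.
rewrite scatter_hecke' !(flipC i) -foldr_flip //.
have := foldr_scatter_linear (ordS i) l t (flip (ordS i) i f) 0.
have -> : foldr (scatter (ordS i)) 0 l = 0.
  by elim: l {il Sl} => //= j l ->; rewrite linear0.
by rewrite !addr0.
Qed.

Definition bell_op j f : fn :=
  [ffun eta : C => \sum_(zeta : C) bell_prob t j eta zeta * f zeta].

Lemma bell_opE j f eta :
  bell_op j f eta = \sum_(zeta : C) bell_prob t j eta zeta * f zeta.
Proof. by rewrite ffunE. Qed.

Lemma bell_op_linear j : linear (bell_op j).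
Proof.
move=> a f g; apply/ffunP => eta.
rewrite fn_addE fn_scaleE !bell_opE mulr_sumr -big_split; apply: eq_bigr => zeta _.
by rewrite fn_addE fn_scaleE /=; ring.
Qed.

HB.instance Definition _ j := GRing.isLinear.Build R fn fn _ _ (@bell_op_linear j).
End Operators.

(** * The cascade as a site-by-site walk *)

Section Relay.
Variables (R : realType) (n : nat) (t : R).
Hypotheses (t_ge0 : 0 <= t) (t_lt1 : t < 1).
Implicit Types (c eta cur zeta : {ffun 'I_n -> nat}) (i j k p q : 'I_n).

Lemma lap_cons p :
  exists l, lap p = ordS p :: l /\ lap (ordS p) = rcons l (ordS p).
Proof.
have := iter_ordS_n (ordS p); rewrite /lap.
case: (n) p => [|n'] p; first by case: p.
move=> e; rewrite (trajectSr _ (ordS (ordS p))) -iterSr e.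
by exists (traject (@ordS n'.+1) (ordS (ordS p)) n').
Qed.

Lemma qint_mul m : (1 - t) * qint t m = 1 - t ^+ m.
Proof.
elim: m => [|m IHm]; first by rewrite /qint big_ord0 mulr0 expr0 subrr.
by rewrite /qint big_ord_recr /= mulrDr IHm exprS; ring.
Qed.

Lemma qint_gt0 m : (0 < m)%N -> 0 < qint t m.
Proof.
move=> m_gt0; rewrite -(pmulr_rgt0 _ (_ : 0 < 1 - t)) ?subr_gt0 // qint_mul.
by rewrite subr_gt0 exprn_ilt1 // -lt0n.
Qed.

Definition geom_sum (g : 'I_n -> R) (s : seq 'I_n) : R :=
  foldr (fun q acc => g q + t * acc) 0 s.

Lemma geom_sumE g p s :
  \sum_(i < size s) t ^+ i * g (nth p s i) = geom_sum g s.
Proof.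
elim: s => [|q s IHs] /=; first by rewrite big_ord0.
rewrite big_ord_recl /= expr0 mul1r -IHs mulr_sumr; congr (_ + _).
by apply: eq_bigr => i _; rewrite mulrA -exprS.
Qed.

Lemma geom_sum_rcons g s q :
  geom_sum g (rcons s q) = geom_sum g s + t ^+ size s * g q.
Proof.
elim: s => [|h s IHs] /=; first by rewrite expr0; ring.
by rewrite IHs exprS; ring.
Qed.

Definition weaker j p c := [seq i <- lap p | (c i < c j)%N].

(* The cascade seen as a single particle whose species is stored at the bell  *)
(* site j: settling at q exchanges the contents of j and q, and p is only the *)
(* place where the next search starts.                                        *)
Fixpoint relay (fuel : nat) j p c zeta : R :=
  if fuel is fuel'.+1 then
    if c j == 0%N then (c == zeta)%:R
    else (qint t (size (weaker j p c)))^-1 *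
      geom_sum (fun q => relay fuel' j q (raw_swap c j q) zeta) (weaker j p c)
  else 0.

Lemma eq_geom_sum g1 g2 s : {in s, g1 =1 g2} -> geom_sum g1 s = geom_sum g2 s.
Proof.
elim: s => //= q s IHs e; rewrite e ?mem_head // IHs // => h hs.
by apply: e; rewrite inE hs orbT.
Qed.

(** The invariants say that sites weaker than the active particle are untouched and that no other
    site has become weaker, so searching in [eta] or in the current configuration gives the same
    list. *)
Lemma cascade_relay fuel eta j p cur zeta : cur j = 0%N ->
  (forall q, (eta q < eta p)%N -> q != j /\ cur q = eta q) ->
  (forall q, q != j -> (eta p <= eta q)%N -> (eta p <= cur q)%N) ->
  cascade_prob t fuel eta p cur zeta =
  relay fuel j p (set_site cur j (eta p)) zeta.
Proof.
elim: fuel p cur => //= fuel IH p cur curj low high.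
rewrite ffunE eqxx; case: eqP => [p0|/eqP p0].
  congr ((_ == _)%:R); apply/ffunP => i; rewrite ffunE.
  by case: eqP => // ->; rewrite p0.
have <- : weaker_sites eta p = weaker j p (set_site cur j (eta p)).
  apply: eq_in_filter => q _; rewrite !ffunE eqxx.
  case: (eqVneq q j) => [->|qj].
    by rewrite ltnn; apply/negP => /low[]; rewrite eqxx.
  case: (ltnP (eta q) (eta p)) => [/low[_ ->]|/(high _ qj)] //.
  by rewrite leqNgt => /negbTE ->.
rewrite -(geom_sumE _ p) mulr_sumr; apply: eq_bigr => i _.
rewrite mulrA [X in X * _]mulrC; congr (_ * _).
set q := nth _ _ _; have : q \in weaker_sites eta p by apply: mem_nth.
rewrite mem_filter => /andP[qp _]; have [qj curq] := low _ qp.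
rewrite IH.
- congr relay; apply/ffunP => k; rewrite !ffunE !permE /=.
  case: (eqVneq k j) => [_|kj]; first by rewrite (negbTE qj) curq.
  by case: (eqVneq k q) => [_|kq]; rewrite ?eqxx // (negbTE kj).
- by rewrite ffunE eq_sym (negbTE qj).
- move=> h hq; have [hj curh] := low _ (ltn_trans hq qp).
  by split=> //; rewrite ffunE; case: eqP hq => // ->; rewrite ltnn.
- move=> h hj qh; rewrite ffunE; case: eqP => _; first exact: ltnW.
  case: (ltnP (eta h) (eta p)) => [/low[_ ->]//|/(high _ hj)].
  exact/leq_trans/ltnW.
Qed.

Lemma bell_probE j eta zeta :
  bell_prob t j eta zeta = relay (eta j).+1 j j eta zeta.
Proof.
rewrite /bell_prob (@cascade_relay _ _ j).
- congr relay; apply/ffunP => i; rewrite !ffunE.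
  by case: eqP => // ->.
- by rewrite ffunE eqxx.
- move=> q qj; have qNj : q != j by apply: contraTneq qj => ->; rewrite ltnn.
  by rewrite ffunE (negbTE qNj).
- by move=> q qj; rewrite ffunE (negbTE qj).
Qed.

Lemma relay_fuel m1 m2 j p c zeta : (c j < m1)%N -> (c j < m2)%N ->
  relay m1 j p c zeta = relay m2 j p c zeta.
Proof.
elim: m1 m2 p c => [|m1 IH] [|m2] p c //= h1 h2; case: ifP => // _.
congr (_ * _); apply: eq_geom_sum => q; rewrite mem_filter => /andP[qj _].
have e : raw_swap c j q j = c q by rewrite ffunE tpermL.
by apply: IH; rewrite e; apply: leq_trans qj _; rewrite -ltnS.
Qed.

Lemma relay_ge0 m j p c zeta : 0 <= relay m j p c zeta.
Proof.
elim: m p c => //= m IH p c; case: ifP => // _.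
apply: mulr_ge0; first by rewrite invr_ge0 sumr_ge0 // => i _; apply: exprn_ge0.
by elim: weaker => //= q s IHs; rewrite addr_ge0 ?mulr_ge0.
Qed.

(* Skipping one weaker site costs a factor t; since the search is cyclic,     *)
(* this one-site recursion encodes the whole geometric choice.                *)
Lemma relay_step j p c zeta (q := ordS p) (c' := raw_swap c j q) :
  relay (c j).+1 j p c zeta =
  if (c q < c j)%N then
    (1 - t) * relay (c' j).+1 j q c' zeta + t * relay (c j).+1 j q c zeta
  else relay (c j).+1 j q c zeta.
Proof.
have [l [lp lq]] := lap_cons p; have c'j : c' j = c q by rewrite ffunE tpermL.
rewrite c'j; set g := relay (c q).+1 _ _ _ _.
rewrite [relay (c j).+1 _ _ _ _]/= [relay (c j).+1 _ q _ _]/=.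
case: ifP => [/eqP ->|/eqP/eqP cj0] //.
rewrite /weaker lp lq filter_rcons /= -/q; case: ifP => // qj.
rewrite size_rcons geom_sum_rcons /=; set m := size _; set G := geom_sum _ _.
rewrite (relay_fuel _ _ (m2 := (c q).+1)) ?c'j // -/c' -/g.
have := qint_mul m.+1; have := qint_gt0 (isT : (0 < m.+1)%N).
set Q := qint _ _ => Q0 Qm; have {}Qm : t ^+ m.+1 = 1 - (1 - t) * Q by lra.
rewrite exprS in Qm.
have -> : t * (Q^-1 * (G + t ^+ m * g)) = Q^-1 * (t * G + (t * t ^+ m) * g) by ring.
by rewrite Qm; field; rewrite gt_eqF.
Qed.

End Relay.

(** * Bell operators and their relations with T *)

Section Bell.
Variables (R : realType) (n : nat) (lam : n.-tuple nat) (t : R).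
Hypotheses (t_ge0 : 0 <= t) (t_lt1 : t < 1).
Local Notation C := (config lam).
Local Notation fn := {ffun C -> R^o}.
Implicit Types (f g h : fn) (eta zeta : C) (i j k : 'I_n).

Let relay_mean j p f : fn :=
  [ffun eta : C => \sum_(zeta : C) relay t (eta j).+1 j p eta zeta * f zeta].

Let relay_mean_step j p f :
  relay_mean j p f = scatter t j (ordS p) (relay_mean j (ordS p) f).
Proof.
apply/ffunP => eta; rewrite scatterE !(ffunE (fun eta : C => \sum_(zeta : C) _)).
under eq_bigr do rewrite relay_step //.
case: ifP => // _; rewrite !mulr_sumr -big_split; apply: eq_bigr => zeta _ /=.
by ring.
Qed.

(** Iterating the one-site recursion around the whole ring brings the search back to its starting
    place. *)
Lemma lap_bell j f : lap_op t j (bell_op t j f) = bell_op t j f.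
Proof.
have -> : bell_op t j f = relay_mean j j f.
  apply/ffunP => eta; rewrite bell_opE ffunE; apply: eq_bigr => zeta _.
  by rewrite bell_probE.
have lapm m p : foldr (scatter t j) (relay_mean j (iter m (@ordS n) p) f)
    (traject (@ordS n) (ordS p) m) = relay_mean j p f.
  elim: m p => //= m IHm p.
  by rewrite -iterS iterSr IHm -relay_mean_step.
by rewrite -[RHS](lapm n) iter_ordS_n.
Qed.

Lemma bell_vacant j f eta : eta j = 0%N -> bell_op t j f eta = f eta.
Proof.
move=> eta0; rewrite bell_opE (bigD1 eta) //= big1 ?addr0 => [|zeta /negbTE zE].
  by rewrite /bell_prob eta0 /= eta0 /= (_ : set_site _ _ _ = eta) ?eqxx ?mul1r //;
     apply/ffunP => i; rewrite ffunE; case: eqP => // ->.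
rewrite /bell_prob eta0 /= eta0 /= (_ : set_site _ _ _ = eta); last first.
  by apply/ffunP => i; rewrite ffunE; case: eqP => // ->.
by rewrite (inj_eq val_inj) eq_sym zE mul0r.
Qed.

Lemma bell_ge0 j f eta : (forall zeta, 0 <= f zeta) -> 0 <= bell_op t j f eta.
Proof.
move=> f_ge0; rewrite bell_opE sumr_ge0 // => zeta _.
by rewrite mulr_ge0 ?bell_probE ?relay_ge0.
Qed.

Hypothesis lam0 : 0%N \in lam.

Lemma vacancy eta : exists k, eta k = 0%N.
Proof.
have : 0%N \in codom eta by rewrite (perm_mem (configP eta)).
by case/codomP => k ->; exists k.
Qed.

Lemma foldr_scatter_small j h r l eta :
  (forall zeta, (zeta j < r)%N -> h zeta = 0) -> (eta j < r)%N ->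
  foldr (scatter t j) h l eta = 0.
Proof.
move=> h0; elim: l eta => [|k l IHl] eta etar /=; first exact: h0.
rewrite scatterE (IHl eta) // mulr0 addr0; case: ifP => // kj.
by rewrite IHl ?mulr0 // swapE tpermL (ltn_trans kj).
Qed.

(** Settling anywhere lowers the species at [j], where [h] vanishes; only the path skipping every
    weaker site survives. *)
Lemma foldr_scatter_top j h l eta :
  (forall zeta, (zeta j < eta j)%N -> h zeta = 0) ->
  foldr (scatter t j) h l eta = t ^+ count (fun k => (eta k < eta j)%N) l * h eta.
Proof.
move=> h0; elim: l => [|k l IHl] /=; first by rewrite expr0 mul1r.
rewrite scatterE IHl; case: ifP => // kj.
rewrite (foldr_scatter_small _ h0) ?swapE ?tpermL // mulr0 add0r.
by rewrite add1n exprS mulrA.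
Qed.

(* Without vacancy at j a lap either lowers the species stored at j or costs  *)
(* a factor t ^+ m with m > 0, so a fixed point of the lap operator is        *)
(* determined by its values on the configurations vacant at j.                *)
Lemma lap_fixed_unique j f g : lap_op t j f = f -> lap_op t j g = g ->
  (forall eta, eta j = 0%N -> f eta = g eta) -> f = g.
Proof.
move=> ff gg fg; apply/eqP; rewrite -subr_eq0; set h := f - g.
have hh : lap_op t j h = h by rewrite linearB /= ff gg.
apply/eqP/ffunP => eta; rewrite [RHS]ffunE.
have [r] := ubnP (eta j); elim: r eta => // r IHr eta; rewrite ltnS => etar.
case: (posnP (eta j)) => [eta0|eta_gt0]; first by rewrite fn_addE fn_oppE fg ?subrr.
have := foldr_scatter_top (lap j) (fun zeta zj => IHr zeta (leq_trans zj etar)).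
rewrite -/(lap_op t j h) hh; set m := count _ _ => /eqP.
rewrite -subr_eq0 -{1}(mul1r (h eta)) -mulrBl mulf_eq0 subr_eq0 => /orP[|/eqP //].
have m_gt0 : (0 < m)%N.
  rewrite -has_count; apply/hasP; have [k k0] := vacancy eta.
  by exists k; rewrite ?mem_lap ?k0.
by rewrite eq_sym lt_eqF // exprn_ilt1 // -lt0n.
Qed.

Definition cst (a : R) : fn := [ffun=> a].

Lemma cstE a eta : cst a eta = a.
Proof. by rewrite ffunE. Qed.

Lemma scatter_cst j k a : scatter t j k (cst a) = cst a.
Proof. by apply/ffunP => eta; rewrite scatterE !cstE; case: ifP => // _; ring. Qed.

(** Total mass one of the outcome law of a bell, from uniqueness instead of a sum over cascades. *)
Lemma bell_cst j a : bell_op t j (cst a) = cst a.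
Proof.
apply: (@lap_fixed_unique j) => [||eta]; first exact: lap_bell.
  by rewrite /lap_op; elim: (lap j) => //= k l ->; rewrite scatter_cst.
exact: bell_vacant.
Qed.

Lemma bell_hecke_far i j f : i != ordS i -> j != i -> j != ordS i ->
  bell_op t j (hecke t i (ordS i) f) = hecke t i (ordS i) (bell_op t j f).
Proof.
move=> iS ji jS; apply: (@lap_fixed_unique j); first exact: lap_bell.
  by rewrite lap_hecke_far // lap_bell.
move=> eta eta0; rewrite bell_vacant // /hecke !(scatterE, flipE) !swapK.
by rewrite !bell_vacant // swapE tpermD // eq_sym.
Qed.

Lemma bell_hecke i f : i != ordS i ->
  bell_op t i (hecke t i (ordS i) f) = hecke t i (ordS i) (bell_op t (ordS i) f).
Proof.
move=> iS; apply: (@lap_fixed_unique i); first exact: lap_bell.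
  by rewrite lap_hecke // lap_bell.
move=> eta eta0; rewrite bell_vacant // /hecke !(scatterE, flipE).
by rewrite eta0 ltn0 bell_vacant // swapE tpermR.
Qed.

Lemma bell_hecke' i f : i != ordS i ->
  bell_op t (ordS i) (hecke t i (ordS i) f - (1 - t) *: f) =
  hecke t i (ordS i) (bell_op t i f) - (1 - t) *: bell_op t i f.
Proof.
move=> iS; apply: (@lap_fixed_unique (ordS i)); first exact: lap_bell.
  by rewrite lap_hecke' // lap_bell.
move=> eta eta0; rewrite bell_vacant // !fn_addE !fn_oppE !fn_scaleE.
rewrite /hecke !(scatterE, flipE) !swapK eta0.
(* If [i] is occupied, the terms of weight 1 - t cancel and only the exchanged configuration, vacant
   at [i], remains. *)
have swap_vac : swap i (ordS i) eta i = 0%N by rewrite swapE tpermL.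
case: posnP => [eta_i|_]; last by rewrite (bell_vacant f swap_vac); ring.
by rewrite !bell_vacant.
Qed.

End Bell.

(** * A deterministic sorting run, in place of irreducibility *)

Section Sorting.
Local Open Scope nat_scope.
Variables (n : nat) (lam : n.-tuple nat).
Local Notation C := (config lam).
Implicit Types (eta zeta c : C) (i j k : 'I_n).

(* The deterministic cascade in which every active particle settles at the    *)
(* first weaker site.                                                         *)
Definition greedy_step j c k : C := if (c k < c j)%N then swap j k c else c.

Definition greedy j c : C := foldl (greedy_step j) c (lap j).

(** Once [k] is passed it holds at least what [j] holds, and later exchanges only lower the species
    at [j]. *)
Lemma greedy_foldl_min j l c k : (k \in l) || (c j <= c k)%N ->
  (foldl (greedy_step j) c l j <= foldl (greedy_step j) c l k)%N.
Proof.
elim: l c => //= q l IHl c; rewrite inE => h; apply: IHl.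
rewrite /greedy_step; case: (ltnP (c q) (c j)) => qj; last first.
  by case: eqP h => [->|_] //=; rewrite qj orbT.
rewrite !swapE tpermL; case: tpermP => [_|_|/eqP jk /eqP qk].
- by rewrite leqnn orbT.
- by rewrite (ltnW qj) orbT.
move: h; rewrite (negbTE qk) /= => /orP[->//|jck].
by rewrite (leq_trans (ltnW qj) jck) orbT.
Qed.

Lemma greedy_min j c k : (greedy j c j <= greedy j c k)%N.
Proof. by apply: greedy_foldl_min; rewrite mem_lap. Qed.

Lemma val_lap j : map val (lap j) = iota j.+1 (n - j.+1) ++ iota 0 j.+1.
Proof.
have jn := ltn_ord j; apply: (@eq_from_nth _ 0%N).
  by rewrite size_map size_traject size_cat !size_iota subnK.
move=> i; rewrite size_map size_traject => i_n.
rewrite (nth_map j) ?size_traject // /lap (set_nth_default (ordS j)) ?size_traject //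
  nth_traject // -iterSr val_iter_ordS nth_cat.
rewrite size_iota; case: ltnP => h.
  by rewrite nth_iota // modn_small ?addSnnS //; lia.
rewrite nth_iota; last by lia.
have -> : (j + i.+1 = i - (n - j.+1) + n)%N by lia.
by rewrite modnDr modn_small ?add0n //; lia.
Qed.

(* Ringing greedily at 0, ..., m - 1 makes the sites m - 1, ..., 0 hold the m *)
(* smallest species in increasing order, as in a bubble sort.                 *)
Definition settled m c := forall u v : 'I_n, (u < m)%N ->
  ((u < v < m)%N -> (c v <= c u)%N) /\ ((m <= v)%N -> (c u <= c v)%N).

Lemma settled_greedy_foldl m j l c : (m <= j)%N ->
  {in l, forall k : 'I_n, (m <= k)%N} ->
  settled m c -> settled m (foldl (greedy_step j) c l).
Proof.
move=> mj; elim: l c => //= k l IHl c ml mc; apply: IHl => [q ql|].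
  by apply: ml; rewrite inE ql orbT.
have mk : (m <= k)%N by apply: ml; rewrite mem_head.
rewrite /greedy_step; case: ifP => // _ u v um; rewrite !swapE.
have -> : tperm j k u = u by rewrite tpermD //; apply: contraTneq um => <-; rewrite -leqNgt.
have [h1 h2] := mc u (tperm j k v) um; split => [/andP[uv vm]|mv].
  apply: h1; rewrite tpermD ?uv //; apply: contraTneq vm => <-; by rewrite -leqNgt.
by apply: h2; case: tpermP => [||_ _].
Qed.

(* While the particle from m passes the settled sites, having just passed     *)
(* k - 1, the species increase along m - 1, ..., k, m, k - 1, ..., 0, and all *)
(* other sites come last, in no particular order.                             *)
Definition lap_rank (m k v : nat) : nat :=
  if v < k then m - v else if v < m then m.-1 - v
  else if v <= m then m - k else m.+1.

Definition lap_sorted (m k : nat) c := forall u v : 'I_n,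
  (lap_rank m k u < lap_rank m k v)%N -> (c u <= c v)%N.

Lemma lap_rankS j k (u : 'I_n) : (k < j)%N ->
  lap_rank j k.+1 u = lap_rank j k (tperm j k u).
Proof.
move=> kj; rewrite /lap_rank; case: tpermP => [->|->|uj uk].
- by do 6?case: ifP => ?; lia.
- by do 6?case: ifP => ?; lia.
have nuj : nat_of_ord u <> j by move/val_inj.
have nuk : nat_of_ord u <> k by move/val_inj.
by do 6?case: ifP => ?; lia.
Qed.

Lemma lap_sorted_foldl j (k : nat) l c : (k <= j)%N -> map val l = iota k (j - k) ->
  lap_sorted j k c -> lap_sorted j j (foldl (greedy_step j) c l).
Proof.
elim: l k c => [|q l IHl] k c kj /=.
  case e : (j - k)%N => // _; suff -> : k = j by [].
  by lia.
case e : (j - k)%N => [|m] //= [].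
rewrite -[val q]/(nat_of_ord q) => qk ql ck; apply: (IHl k.+1); first by lia.
  by rewrite ql; congr iota; lia.
(* The invariant excludes a stronger [q], and at a tie the exchange is trivial. *)
have -> : greedy_step j c q = swap j q c.
  rewrite /greedy_step; case: ltnP => // jq; rewrite swap_id //.
  apply/eqP; rewrite eqn_leq jq; apply: ck.
  by rewrite /lap_rank; do 6?case: ifP => ?; lia.
have qj : (q < j)%N by rewrite qk; lia.
by move=> u v; rewrite -qk !lap_rankS // !swapE qk; apply: ck.
Qed.

(** The sites after [j] bring the least unsettled species to [j]; passing 0, ..., j - 1 then puts it
    at 0 and shifts the settled species one site on. *)
Lemma settled_greedy j c : settled j c -> settled j.+1 (greedy j c).
Proof.
move=> cj; have jn := ltn_ord j.
have := val_lap j; rewrite -addn1 iotaD add0n addn1 /=.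
pose l1 := take (n - j.+1) (lap j).
pose l2 := take j (drop (n - j.+1) (lap j)).
pose l3 := drop j (drop (n - j.+1) (lap j)).
have lE : lap j = l1 ++ l2 ++ l3 by rewrite !cat_take_drop.
move=> vl.
have v1 : map val l1 = iota j.+1 (n - j.+1).
  by rewrite map_take vl take_size_cat ?size_iota.
have v2 : map val l2 = iota 0 j.
  by rewrite map_take map_drop vl drop_size_cat ?size_iota // take_size_cat ?size_iota.
have v3 : map val l3 = [:: val j].
  by rewrite !map_drop vl drop_size_cat ?size_iota // drop_size_cat ?size_iota.
have {}v3 : l3 = [:: j] by case: l3 v3 {lE} => [|q []] //= [/val_inj ->].
rewrite /greedy lE v3 !foldl_cat /=.
set c1 := foldl _ c l1; have c1j : settled j c1.
  apply: settled_greedy_foldl => // k kl.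
  have : val k \in map val l1 by apply: map_f.
  by rewrite v1 mem_iota => /andP[/ltnW].
have c1min (k : 'I_n) : (j < k)%N -> (c1 j <= c1 k)%N.
  move=> jk; apply: greedy_foldl_min; rewrite -(mem_map val_inj) v1 mem_iota.
  by rewrite -[val k]/(nat_of_ord k); have := ltn_ord k; lia.
have := @lap_sorted_foldl j 0 l2 c1 isT; rewrite subn0 => /(_ v2).
set c2 := foldl _ _ _ => c2s; have {c2s} : lap_sorted j j c2.
  apply: c2s => u v; rewrite /lap_rank !ltn0.
  have [uj|uj|uj] : [\/ u < j, j < u | u = j :> nat].
  - by case: (ltngtP u j); [constructor 1|constructor 2|constructor 3].
  - case: (ltnP v j) => vj; last by have [_ h] := c1j u v uj; rewrite h.
    by have [h _] := c1j v u vj; do 6?case: ifP => ?; move=> ?;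
      first [lia | apply: h; lia].
  - by do 6?case: ifP => ?; lia.
  - by do 6?case: ifP => ?; rewrite ?(val_inj uj) => ?;
      first [lia | apply: c1min; lia].
rewrite /greedy_step ltnn => c2s u v; rewrite ltnS => uj.
split=> [/andP[uv]|]; rewrite ?ltnS => vj; apply: c2s; rewrite /lap_rank;
  by do 6?case: ifP => ?; lia.
Qed.

Definition greedy_sort c : C := foldl (fun c j => greedy j c) c (enum 'I_n).

Lemma greedy_sort_settled c : settled n (greedy_sort c).
Proof.
have H m : (m <= n)%N ->
    settled m (foldl (fun c j => greedy j c) c (take m (enum 'I_n))).
  elim: m => [|m IHm] mn; first by rewrite take0 => u v.
  rewrite (take_nth (Ordinal mn)) ?size_enum_ord // -cats1 foldl_cat /=.
  have {1}-> : m = nth (Ordinal mn) (enum 'I_n) m by rewrite nth_enum_ord.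
  by apply: settled_greedy; rewrite nth_enum_ord //; apply: IHm; apply: ltnW.
by have := H n (leqnn n); rewrite take_oversize ?size_enum_ord.
Qed.

Lemma settled_unique c c' : settled n c -> settled n c' -> c = c'.
Proof.
have sortedP (d : C) : settled n d -> sorted geq (codom d).
  move=> dn; rewrite codomE sorted_map.
  have : sorted ltn (map val (enum 'I_n)) by rewrite val_enum_ord iota_ltn_sorted.
  rewrite sorted_map; apply: sub_sorted => u v /= uv.
  by have [h _] := dn u v (ltn_ord u); apply: h; rewrite uv /=.
move=> cn cn'; have e : codom c = codom c'.
  apply: (@sorted_eq _ geq).
  - by move=> a b d ab bd; apply: leq_trans ab.
  - by move=> a b; rewrite andbC => /anti_leq.
  - exact: sortedP.
  - exact: sortedP.
  - by apply: perm_trans (configP c) _; rewrite perm_sym configP.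
apply: config_eqP => k; move: e; rewrite !codomE => /eq_in_map; apply.
by rewrite mem_enum.
Qed.

Lemma greedy_sort_unique c c' : greedy_sort c = greedy_sort c'.
Proof. by apply: settled_unique; apply: greedy_sort_settled. Qed.

End Sorting.

(** * Harmonic functions and the range of the generator *)

Section Generator.
Variables (R : realType) (n : nat) (lam : n.-tuple nat) (t : R).
Hypotheses (t_ge0 : 0 <= t) (t_lt1 : t < 1) (lam0 : 0%N \in lam).
Local Notation C := (config lam).
Local Notation fn := {ffun C -> R^o}.
Local Notation cst := (@cst R n lam).
Implicit Types (f g h : fn) (eta zeta : C) (i j k : 'I_n) (x : 'I_n -> R).

Definition gen_op x f : fn := \sum_(j < n) (x j)^-1 *: (bell_op t j f - f).

Lemma gen_opE x f eta :
  gen_op x f eta = \sum_(j < n) (x j)^-1 * (bell_op t j f eta - f eta).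
Proof.
rewrite /gen_op sum_ffunE; apply: eq_bigr => j _.
by rewrite fn_scaleE fn_addE fn_oppE.
Qed.

Lemma gen_op_linear x : linear (gen_op x).
Proof.
move=> a f g; rewrite /gen_op scaler_sumr -big_split; apply: eq_bigr => j _ /=.
rewrite linearP scalerA mulrC -scalerA -scalerDr; congr (_ *: _).
by rewrite scalerBr opprD addrACA.
Qed.

HB.instance Definition _ x := GRing.isLinear.Build R fn fn _ _ (@gen_op_linear x).

Lemma stationary_gen_op x (pi : C -> R) f : is_stationary t x pi ->
  \sum_eta pi eta * gen_op x f eta = 0.
Proof.
case=> _ _ stat.
have genE eta : gen_op x f eta = \sum_(zeta : C) generator t x eta zeta * f zeta.
  rewrite (bigD1 eta) //= {1}/generator eqxx mulNr mulr_suml.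
  rewrite [X in _ + X](eq_bigr (fun zeta : C => jump_rate t x eta zeta * f zeta)); last first.
    by move=> zeta ne; rewrite /generator eq_sym (negbTE ne).
  rewrite addrC -sumrB gen_opE.
  transitivity (\sum_(zeta : C) jump_rate t x eta zeta * (f zeta - f eta)); last first.
    rewrite (bigD1 eta) //= subrr mulr0 add0r.
    by apply: eq_bigr => zeta _; rewrite mulrBr.
  under [RHS]eq_bigr do rewrite mulr_suml.
  rewrite exchange_big; apply: eq_bigr => j _ /=.
  have := bell_cst t_ge0 t_lt1 lam0 j (f eta) => /ffunP/(_ eta).
  rewrite bell_opE cstE => {1}<-; rewrite bell_opE -sumrB mulr_sumr.
  by apply: eq_bigr => zeta _; rewrite cstE; ring.
under eq_bigr do rewrite genE mulr_sumr.
rewrite exchange_big big1 //= => zeta _.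
under eq_bigr do rewrite mulrA.
by rewrite -mulr_suml stat mul0r.
Qed.

Lemma bell_le j f eta a : (forall zeta, f zeta <= a) -> bell_op t j f eta <= a.
Proof.
move=> fa; rewrite -subr_ge0 -{1}(cstE a eta) -(bell_cst t_ge0 t_lt1 lam0 j a).
rewrite -fn_oppE -fn_addE -linearB; apply: bell_ge0 => // zeta.
by rewrite fn_addE fn_oppE cstE subr_ge0.
Qed.

Lemma gen_op_max_le0 x f eta : (forall i, 0 < x i) ->
  (forall zeta, f zeta <= f eta) -> gen_op x f eta <= 0.
Proof.
move=> x_gt0 fmax; rewrite gen_opE; apply: sumr_le0 => j _.
by rewrite pmulr_rle0 ?invr_gt0 // subr_le0 bell_le.
Qed.

Lemma foldr_scatter_ge0 j h l eta :
  (forall zeta, 0 <= h zeta) -> 0 <= foldr (scatter t j) h l eta.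
Proof.
move=> h_ge0; elim: l eta => //= k l IHl eta; rewrite scatterE.
by case: ifP => _ //; rewrite addr_ge0 // mulr_ge0 // subr_ge0 ltW.
Qed.

(** The greedy path has positive weight, each exchange contributing 1 - t. *)
Lemma foldr_scatter_greedy j h l eta : (forall zeta, 0 <= h zeta) ->
  foldr (scatter t j) h l eta = 0 -> h (foldl (greedy_step j) eta l) = 0.
Proof.
move=> h_ge0; elim: l eta => //= k l IHl eta; rewrite scatterE /greedy_step.
case: ifP => _; last exact: IHl.
move=> /eqP; rewrite paddr_eq0 ?mulr_ge0 ?foldr_scatter_ge0 ?subr_ge0 ?(ltW t_lt1) //.
by rewrite mulf_eq0 subr_eq0 gt_eqF //= => /andP[/eqP/IHl].
Qed.

Lemma bell_greedy j h eta : (forall zeta, 0 <= h zeta) ->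
  bell_op t j h eta = 0 -> h (greedy j eta) = 0.
Proof.
move=> h_ge0; rewrite -lap_bell // => /foldr_scatter_greedy H.
(* The greedy outcome is vacant at [j], so there the bell acts trivially. *)
have vac : greedy j eta j = 0%N.
  have [k k0] := vacancy lam0 (greedy j eta).
  by apply/eqP; rewrite -leqn0 -k0 greedy_min.
by rewrite -(bell_vacant t h vac); apply: H => zeta; apply: bell_ge0.
Qed.

(** At a maximum all bell terms are nonpositive and sum to zero, so each vanishes. *)
Lemma harmonic_max_greedy x f eta j : (forall i, 0 < x i) -> gen_op x f = 0 ->
  (forall zeta, f zeta <= f eta) -> f (greedy j eta) = f eta.
Proof.
move=> x_gt0 harm fmax.
have bellj : bell_op t j f eta = f eta.
  have := gen_opE x f eta; rewrite harm [LHS]ffunE => /esym/eqP.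
  rewrite -oppr_eq0 -sumrN psumr_eq0 => [/allP/(_ j)|i _]; last first.
    by rewrite oppr_ge0 pmulr_rle0 ?invr_gt0 // subr_le0 bell_le.
  rewrite mem_index_enum => /(_ isT).
  by rewrite oppr_eq0 mulf_eq0 invr_eq0 gt_eqF //= subr_eq0 => /eqP.
have := @bell_greedy j (cst (f eta) - f) eta.
rewrite linearB /= bell_cst // !fn_addE !fn_oppE !cstE bellj subrr => H.
apply/esym/subr0_eq/H => // zeta.
by rewrite fn_addE fn_oppE cstE subr_ge0.
Qed.

Lemma harmonic_max_sort x f eta : (forall i, 0 < x i) -> gen_op x f = 0 ->
  (forall zeta, f zeta <= f eta) -> f (greedy_sort eta) = f eta.
Proof.
move=> x_gt0 harm; rewrite /greedy_sort.
elim: (enum 'I_n) eta => //= j l IHl eta fmax.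
have e := harmonic_max_greedy j x_gt0 harm fmax.
by rewrite IHl e.
Qed.

Lemma fn_argmax f eta0 : exists eta, forall zeta, f zeta <= f eta.
Proof.
by case: (arg_maxP f (erefl true : predT eta0)) => eta _ h; exists eta => zeta; apply: h.
Qed.

(** Maximum and minimum are both attained at the common sorted configuration. *)
Lemma harmonic_cst x f eta0 : (forall i, 0 < x i) -> gen_op x f = 0 ->
  f = cst (f eta0).
Proof.
move=> x_gt0 harm.
have [eta1 fmax] := fn_argmax f eta0; have [eta2 fmin] := fn_argmax (- f) eta0.
have harmN : gen_op x (- f) = 0 by rewrite linearN /= harm oppr0.
have := harmonic_max_sort x_gt0 harmN fmin; rewrite !fn_oppE => /oppr_inj e2.
have e1 := harmonic_max_sort x_gt0 harm fmax.
rewrite (greedy_sort_unique eta2 eta1) e1 in e2.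
have fe zeta : f zeta = f eta1.
  by apply/le_anti; rewrite fmax e2 -lerN2 -!fn_oppE fmin.
by apply/ffunP => zeta; rewrite cstE !fe.
Qed.

(* [mean x f a]: modulo the range of the generator, f is the constant a; any  *)
(* stationary distribution then integrates f to a.                            *)
Definition mean x f a := exists g, f = gen_op x g + cst a.

Lemma mean_unique x f a b eta0 : (forall i, 0 < x i) ->
  mean x f a -> mean x f b -> a = b.
Proof.
move=> x_gt0 [g ->] [h gh].
have {}gh : gen_op x (h - g) = cst (a - b).
  apply/ffunP => zeta; have /ffunP/(_ zeta) := gh.
  rewrite linearB /= !fn_addE !fn_oppE !cstE; lra.
(* Evaluate at a maximum of [g']. *)
have key g' c : gen_op x g' = cst c -> c <= 0.
  move=> e; have [eta /(gen_op_max_le0 x_gt0)] := fn_argmax g' eta0.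
  by rewrite e cstE.
have h1 := key _ _ gh.
have h2 : b - a <= 0.
  apply: (key (- (h - g))); rewrite linearN /= gh.
  by apply/ffunP => zeta; rewrite fn_oppE !cstE opprB.
by lra.
Qed.

(** Rank-nullity: the kernel has dimension at most one, and [cst 1] lies outside the range, hence
    spans a complement. *)
Lemma mean_exists x f eta0 : (forall i, 0 < x i) -> exists a, mean x f a.
Proof.
move=> x_gt0; pose L : 'End(fn) := linfun (gen_op x).
have LE g : L g = gen_op x g by rewrite lfunE.
have ker1 : (\dim (lker L) <= 1)%N.
  have sub : (lker L <= <[cst 1]>)%VS.
    apply/subvP => g; rewrite memv_ker LE => /eqP/harmonic_cst -/(_ eta0 x_gt0) ->.
    apply/vlineP; exists (g eta0); apply/ffunP => zeta.
    by rewrite fn_scaleE !cstE mulr1.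
  by apply: leq_trans (dimvS sub) _; rewrite dim_vline leq_b1.
have cst1 : cst 1 \notin limg L.
  apply/negP => /memv_imgP[g _]; rewrite LE => e.
  have : mean x (cst 1) 0.
    by exists g; rewrite e; apply/ffunP => zeta; rewrite fn_addE cstE addr0.
  have : mean x (cst 1) 1 by exists 0; rewrite linear0 add0r.
  by move=> m1 /(mean_unique eta0 x_gt0 m1)/eqP; rewrite oner_eq0.
have full : (limg L + <[cst 1]> = fullv)%VS.
  apply/eqP; rewrite eqEdim subvf /= dimv_disjoint_sum.
    have := limg_ker_dim L fullv; rewrite capfv => <-.
    rewrite addnC leq_add2l dim_vline.
    have -> : (cst 1 != 0) by apply: contraNneq cst1 => ->; apply: mem0v.
    exact: ker1.
  apply/eqP; rewrite -subv0; apply/subvP => g; rewrite memv_cap.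
  case/andP=> gL /vlineP[a ga]; rewrite ga in gL *.
  case: (eqVneq a 0) => [->|a0]; first by rewrite scale0r mem0v.
  by move: gL; rewrite rpredZeq (negbTE a0) (negbTE cst1).
have : f \in (limg L + <[cst 1]>)%VS by rewrite full memvf.
case/memv_addP => g /memv_imgP[g' _ gE] [h /vlineP[a hE] ->].
exists a, g'; rewrite gE hE LE; congr (_ + _).
by apply/ffunP => zeta; rewrite fn_scaleE !cstE mulr1.
Qed.

Lemma mean_stationary x (pi : C -> R) f a :
  is_stationary t x pi -> mean x f a -> \sum_eta pi eta * f eta = a.
Proof.
move=> stat [g ->]; have [_ pi1 _] := stat.
under eq_bigr do rewrite fn_addE cstE mulrDr.
by rewrite big_split /= (stationary_gen_op g stat) -mulr_suml pi1 mul1r add0r.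
Qed.

End Generator.

(** * Exchanging parameters *)

Section Symmetry.
Variables (R : realType) (n : nat) (lam : n.-tuple nat) (t : R).
Hypotheses (t_ge0 : 0 <= t) (t_lt1 : t < 1) (lam0 : 0%N \in lam).
Local Notation C := (config lam).
Local Notation fn := {ffun C -> R^o}.
Implicit Types (f g h : fn) (eta zeta : C) (i j k : 'I_n) (x : 'I_n -> R).

(** This is Q, used with the bell rates of [i] and [k] as [a] and [b]. *)
Definition exchange_op (a b : R) i k f : fn :=
  (b * (1 - t)) *: f + (a - b) *: hecke t i k f.

Lemma exchange_op_linear a b i k : linear (exchange_op a b i k).
Proof.
move=> c f g; rewrite /exchange_op hecke_linear; apply/ffunP => eta.
by rewrite !(fn_addE, fn_scaleE); ring.
Qed.

HB.instance Definition _ a b i k :=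
  GRing.isLinear.Build R fn fn _ _ (@exchange_op_linear a b i k).

Lemma gen_op_exchange x i f (k := ordS i) : i != k ->
  gen_op t x (exchange_op (x i)^-1 (x k)^-1 i k f) =
  exchange_op (x i)^-1 (x k)^-1 i k (gen_op t (fun j => x (tperm i k j)) f).
Proof.
move=> ik; set a := (x i)^-1; set b := (x k)^-1.
rewrite /gen_op linear_sum (bigD1 i) //= [RHS](bigD1 i) //=.
rewrite (bigD1 k) 1?eq_sym //= [in RHS](bigD1 k) 1?eq_sym //=.
rewrite tpermL tpermR -/a -/b !addrA; congr (_ + _); last first.
  apply: eq_bigr => j /andP[ji jk]; rewrite tpermD 1?eq_sym // linearZ /=.
  congr (_ *: _); rewrite linearB; congr (_ - _).
  by rewrite /exchange_op bell_op_linear [bell_op t j (_ *: _)]linearZ /= bell_hecke_far.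
have e1 := bell_hecke t_ge0 t_lt1 lam0 f ik.
have e2 := bell_hecke' t_ge0 t_lt1 lam0 f ik.
rewrite -/k linearB linearZ /= in e1 e2.
rewrite /exchange_op !bell_op_linear ![bell_op t _ (_ *: _)]linearZ /= e1.
rewrite [hecke t i k (b *: _)]linearZ [hecke t i k (a *: _)]linearZ /=.
rewrite ![hecke t i k (_ - _)]linearB /=.
(* Completes the term to T - (1 - t), the form in which [e2] applies. *)
rewrite -(subrK ((1 - t) *: bell_op t k f) (bell_op t k (hecke t i k f))) e2.
apply/ffunP => eta; rewrite !(fn_addE, fn_oppE, fn_scaleE).
by ring.
Qed.

Lemma eq_mean x y f c : x =1 y -> mean t x f c -> mean t y f c.
Proof.
move=> xy [g ->]; exists g; congr (_ + _); apply/ffunP => eta.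
by rewrite !gen_opE; apply: eq_bigr => j _; rewrite xy.
Qed.

(** T fixes [f] and constants, so Q multiplies both by a - t b; apply Q to the equation for x' and
    divide. *)
Lemma mean_adjacent_regular x i f c (k := ordS i) : i != k ->
  (forall eta, f (swap i k eta) = f eta) -> (x i)^-1 != t * (x k)^-1 ->
  mean t (fun j => x (tperm i k j)) f c -> mean t x f c.
Proof.
move=> ik finv reg [g fE]; set a := (x i)^-1 in reg; set b := (x k)^-1 in reg.
have ab : a - t * b != 0 by rewrite subr_eq0.
exists ((a - t * b)^-1 *: exchange_op a b i k g).
rewrite linearZ /= gen_op_exchange // -/a -/b -/k.
have -> : gen_op t (fun j => x (tperm i k j)) g = f - cst lam c by rewrite fE addrK.
apply/ffunP => eta; rewrite /exchange_op [hecke t i k (_ - _)]linearB /=.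
have -> : hecke t i k f = f.
  apply/ffunP => zeta; rewrite /hecke scatterE !flipE swapK finv.
  by case: ifP => _ //; ring.
have -> : hecke t i k (cst lam c) = cst lam c.
  by apply/ffunP => zeta; rewrite /hecke scatterE !flipE !cstE; case: ifP => _ //; ring.
rewrite !(fn_addE, fn_oppE, fn_scaleE) !cstE.
by field.
Qed.

Lemma mean_adjacent x i f c (k := ordS i) : (forall j, 0 < x j) -> i != k ->
  (forall eta, f (swap i k eta) = f eta) ->
  mean t x f c -> mean t (fun j => x (tperm i k j)) f c.
Proof.
move=> x_gt0 ik finv; set x' := fun j => x (tperm i k j).
case: (pickP (fun _ : C => true)) => [eta0 _|C0]; last first.
  by move=> _; exists 0; apply/ffunP => eta; have := C0 eta.
have x'_gt0 j : 0 < x' j by apply: x_gt0.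
case: (eqVneq (x i)^-1 (t * (x k)^-1)) => [sing|reg] fc; last first.
  (* Transport goes from [x'] to [x], so take the mean at [x'] and identify it by uniqueness at
     [x]. *)
  have [c' fc'] := mean_exists t_ge0 t_lt1 lam0 f eta0 x'_gt0.
  have := mean_adjacent_regular ik finv reg fc'.
  by move/(mean_unique t_ge0 t_lt1 lam0 eta0 x_gt0 fc) ->.
(* For [x'] the scalar is b - t a = b (1 - t^2), which is positive. *)
apply: (mean_adjacent_regular ik finv); rewrite -/k.
  rewrite /x' tpermL tpermR sing; have := x_gt0 k; rewrite -invr_gt0.
  move: (_^-1) => b b_gt0; rewrite eq_sym mulrA lt_eqF //.
  by rewrite gtr_pMl // mulr_ilt1.
by apply: eq_mean fc => j; rewrite /x' tpermK.
Qed.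

Lemma mean_tperm x i k f c : (forall j, 0 < x j) -> (i < k)%N ->
  (forall u v : 'I_n, (i <= u)%N -> (i <= v)%N ->
     forall eta, f (swap u v eta) = f eta) ->
  mean t x f c -> mean t (fun j => x (tperm i k j)) f c.
Proof.
have [m] := ubnP (k - i); elim: m i k x => // m IHm i k x.
rewrite ltnS => kim x_gt0 ik finv.
have n_gt : (i.+1 < n)%N by apply: leq_ltn_trans ik (ltn_ord k).
have Si : ordS i = i.+1 :> nat by rewrite /= modn_small.
have iS : i != ordS i by apply/eqP => /(congr1 val) /=; rewrite modn_small //; lia.
have adj y : (forall j, 0 < y j) -> mean t y f c ->
    mean t (fun j => y (tperm i (ordS i) j)) f c.
  by move=> y_gt0; apply: mean_adjacent => // eta; apply: finv; rewrite ?Si.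
case: (eqVneq k (ordS i)) => [->|kS]; first exact: adj.
have Sk : (ordS i < k)%N.
  by rewrite ltn_neqAle Si ik andbT -Si; apply: contra kS => /eqP/val_inj ->.
move=> /(adj _ x_gt0) fc; set y := fun j => x _ in fc.
have y_gt0 j : 0 < y j by apply: x_gt0.
have z_gt0 j : 0 < y (tperm (ordS i) k j) by apply: y_gt0.
have {}fc : mean t (fun j => y (tperm (ordS i) k j)) f c.
  by apply: IHm => // [|u v iu iv]; [rewrite Si; lia|apply: finv; lia].
apply: eq_mean (adj _ z_gt0 fc) => j; rewrite /y; congr (x _).
(* Conjugating by the adjacent transposition shortens the distance by one. *)
have -> : tperm i k = (tperm (ordS i) k ^ tperm i (ordS i))%g.
  by rewrite tpermJ tpermR tpermD // 1?eq_sym //; apply/eqP => e; rewrite e ltnn in ik.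
by rewrite conjgE tpermV !permM.
Qed.

Lemma mean_perm x (m : nat) (s : {perm 'I_n}) f c : (forall j, 0 < x j) ->
  (forall i, (i < m)%N -> s i = i) ->
  (forall u v : 'I_n, (m <= u)%N -> (m <= v)%N ->
     forall eta, f (swap u v eta) = f eta) ->
  mean t x f c -> mean t (fun j => x (s j)) f c.
Proof.
have [r] := ubnP #|[pred i | s i != i]|; elim: r x s => // r IHr x s.
rewrite ltnS => moved x_gt0 s_fix finv fc.
have [i /= si|s1] := pickP [pred i | s i != i]; last first.
  by apply: eq_mean fc => j; have /eqP -> := negbFE (s1 j).
have mi : (m <= i)%N by rewrite leqNgt; apply: contra si => /s_fix ->.
have msi : (m <= s i)%N.
  by rewrite leqNgt; apply: contra si => /s_fix/perm_inj ->.
(* [s2] fixes [i] and every fixed point of [s], so it moves fewer sites. *)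
pose u := tperm i (s i); pose s2 := (s * u)%g.
have s2_fix j : s j = j -> s2 j = j.
  move=> sj; rewrite permM sj tpermD //; first by apply: contraNneq si => ->; rewrite sj.
  by apply: contraNneq si => e; rewrite e (perm_inj (etrans e (esym sj))).
have xu : mean t (fun j => x (u j)) f c.
  have [im|im|/val_inj im] := ltngtP i (s i).
  - by apply: mean_tperm => // v w iv iw; apply: finv; lia.
  - apply: (@eq_mean (fun j => x (tperm (s i) i j))) => [j|]; first by rewrite tpermC.
    by apply: mean_tperm => // v w iv iw; apply: finv; lia.
  - by rewrite -im eqxx in si.
have := IHr (fun j => x (u j)) s2.
have -> : (#|[pred j | s2 j != j]| < r)%N.
  apply: leq_trans moved; apply: proper_card; apply/properP; split.
    by apply/subsetP => j; rewrite !inE; apply: contra => /eqP/s2_fix ->.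
  by exists i; rewrite !inE ?si // permM /u tpermR eqxx.
move=> /(_ isT (fun j => x_gt0 _) (fun j jm => s2_fix j (s_fix j jm)) finv xu).
by apply: eq_mean => j; rewrite permM tpermK.
Qed.

End Symmetry.

Theorem theorem1p4 (R : realType) (n : nat) (lam : n.-tuple nat)
    (x : 'I_n -> R) (t : R) (k : nat) (s : {perm 'I_n})
    (pi pi' : config lam -> R)
    (n_ge2 : (2 <= n)%N)
    (lam_partition : sorted geq lam)
    (lam_vacancy : 0%N \in lam)
    (x_gt0 : forall i, 0 < x i)
    (t_ge0 : 0 <= t) (t_lt1 : t < 1)
    (k_ltn : (k < n)%N)
    (s_fix : forall i : 'I_n, (i < k)%N -> s i = i)
    (pi_stat : is_stationary t x pi)
    (pi'_stat : is_stationary t (fun i => x (s i)) pi') :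
  (forall O : config lam -> R, depends_on_first k O ->
     expectation pi O = expectation pi' O) /\
  (forall A : {set config lam}, depends_on_first k (fun eta => eta \in A) ->
     probability pi A = probability pi' A).
Proof.
have main (O : config lam -> R) : depends_on_first k O ->
    expectation pi O = expectation pi' O.
  move=> Ok; pose f : {ffun config lam -> R^o} := [ffun eta => O eta].
  have E p : expectation p O = \sum_eta p eta * f eta.
    by apply: eq_bigr => eta _; rewrite ffunE.
  case: (pickP (fun _ : config lam => true)) => [eta0 _|C0]; last first.
    by rewrite /expectation !big_pred0 // => eta; have := C0 eta.
  have [c fc] := mean_exists t_ge0 t_lt1 lam_vacancy f eta0 x_gt0.
  have finv (u v : 'I_n) : (k <= u)%N -> (k <= v)%N ->
      forall eta, f (swap u v eta) = f eta.
    move=> ku kv eta; rewrite !(ffunE O); apply: Ok => i ik.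
    rewrite swapE tpermD //.
      by apply: contraTneq ik => <-; rewrite -leqNgt.
    by apply: contraTneq ik => <-; rewrite -leqNgt.
  have fc' := mean_perm t_ge0 t_lt1 lam_vacancy x_gt0 s_fix finv fc.
  rewrite !E (mean_stationary t_ge0 t_lt1 lam_vacancy pi_stat fc).
  by rewrite (mean_stationary t_ge0 t_lt1 lam_vacancy pi'_stat fc').
split=> // A Ak; have E p : probability p A = expectation p (fun eta => (eta \in A)%:R).
  rewrite /probability /expectation big_mkcond; apply: eq_bigr => eta _.
  by case: (eta \in A); rewrite ?mulr1 ?mulr0.
by rewrite !E; apply: main => eta zeta /Ak ->.
Qed.
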